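(* Let $G$ be a $2$-connected graph with an odd number of vertices and at least $4$ vertices. Then $G$ has independence number at most $2$ if and only if $G$ is equimatchable and factor-critical and, for every edge $e$ of the complement $\overline{G}$ of $G$, the graph $G+e$ (obtained from $G$ by adding the edge $e$) is equimatchable.
   Context: All graphs are finite, simple and undirected. A graph is equimatchable if every maximal matching is a maximum matching. A graph is factor-critical if $G-v$ has a perfect matching for every vertex $v$. The independence number is the maximum size of an independent set of vertices. *)

(* Defs.v *)
From mathcomp Require Import all_boot.

Set Implicit Arguments.
Unset Strict Implicit.
Unset Printing Implicit Defensive.

(* A finite simple graph is a symmetric irreflexive adjacency relation on a
   finType; both properties are hypotheses of the theorems that need them. *)
Section Graphs.
Variable T : finType.
Implicit Types (g : rel T) (A f : {set T}) (M : {set {set T}}).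

(* An edge is the two-element set of its endpoints. *)
Definition edges g : {set {set T}} :=
  [set f | [exists x, exists y, g x y && (f == [set x; y])]].

Definition complement g : rel T := [rel x y | (x != y) && ~~ g x y].

Definition add_edge g f : rel T :=
  [rel x y | g x y || (x != y) && (f == [set x; y])].

Definition induced g A : rel {x : T | x \in A} := relpre val g.

Definition independent g A : bool :=
  [forall x in A, forall y in A, ~~ g x y].

Definition independence_number g : nat :=
  \max_(A : {set T} | independent g A) #|A|.

Definition matching g M : bool := (M \subset edges g) && trivIset M.

(* [maxset] is maximality for inclusion. *)
Definition maximal_matching g M : bool := maxset (matching g) M.

Definition maximum_matching g M : bool :=
  matching g M && [forall M' : {set {set T}}, matching g M' ==> (#|M'| <= #|M|)].

Definition perfect_matching g M : bool :=
  matching g M && (cover M == [set: T]).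

Definition equimatchable g : bool :=
  [forall M : {set {set T}}, maximal_matching g M ==> maximum_matching g M].

Definition connected g : bool :=
  (0 < #|T|) && [forall x, forall y, connect g x y].

End Graphs.

Arguments induced {T} g A _ _.

Definition factor_critical (T : finType) (g : rel T) : bool :=
  [forall v, exists M, perfect_matching (induced g [set~ v]) M].

Definition k_connected (k : nat) (T : finType) (g : rel T) : bool :=
  (k < #|T|) && [forall S : {set T}, (#|S| < k) ==> connected (induced g (~: S))].

(* Main.v *)
Require Import Defs.
From mathcomp Require Import all_boot zify.

(** If [x, y, z] are independent in [G], a perfect matching of [G - z] contains
    [xx'] and [yy']; replacing both edges by [x'y'], added to [G] if necessary,
    leaves exactly [x, y, z] uncovered, which is a maximal matching that is not
    maximum.  Conversely, when the independence number is at most [2] a maximal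
    matching misses at most two vertices, hence exactly one by parity.  For
    [G - v], which is connected of even order, suppose [u] and [w] are missed.
    If no augmentation through a single matching edge exists, matched partners
    have the same neighbours in [{u, w}], and each vertex other than [u] and [w]
    is adjacent to exactly one of the two; connectedness yields an edge [ab] with
    [a] on the side of [u] and [b] on the side of [w], and [u a' a b b' w] is an
    augmenting path, where [a'] and [b'] are the partners of [a] and [b]. *)

(** * Matchings of a graph and the vertices they cover *)

Section Matchings.
Context {T : finType} {h : rel T}.
Hypotheses (h_sym : symmetric h) (h_irr : irreflexive h).
Implicit Types (A f : {set T}) (M : {set {set T}}) (x y : T).

Lemma edgesP f :
  reflect (exists x y, h x y /\ f = [set x; y]) (f \in edges h).
Proof.
rewrite inE; apply: (iffP existsP) => [[x /existsP[y /andP[hxy /eqP->]]]|].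
  by exists x, y.
by move=> [x [y [hxy ->]]]; exists x; apply/existsP; exists y; rewrite hxy eqxx.
Qed.

Lemma adjacent_neq {x y} : h x y -> x != y.
Proof. by apply: contraTneq => ->; rewrite h_irr. Qed.

Lemma independentP A :
  reflect {in A &, forall x y, h x y = false} (independent h A).
Proof.
apply: (iffP forall_inP) => [H x y xA yA|H x xA].
  by apply/negbTE/(forall_inP (H x xA)).
by apply/forall_inP => y yA; rewrite H.
Qed.

Lemma matching0 : matching h set0.
Proof.
by rewrite /matching sub0set; apply/trivIsetP => A B; rewrite inE.
Qed.

Lemma matchingD1 {M f} :
  matching h M -> f \in M ->
  matching h (M :\ f) /\ cover (M :\ f) = cover M :\: f.
Proof.
case/andP=> sM tM fM; split; last exact: coverD1.
by rewrite /matching trivIsetD // (subset_trans _ sM) // subD1set.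
Qed.

Lemma matchingU1 {M x y} :
  matching h M -> h x y -> x \notin cover M -> y \notin cover M ->
  matching h ([set x; y] |: M) /\
  cover ([set x; y] |: M) = [set x; y] :|: cover M.
Proof.
case/andP=> sM tM hxy xM yM.
split; last by rewrite /cover bigcup_setU big_set1.
apply/andP; split.
  by rewrite subUset sub1set sM andbT; apply/edgesP; exists x, y.
apply: trivIsetU; rewrite ?trivIset1 ?cover1 //.
by rewrite -setI_eq0 setIUl setU_eq0 !setI_eq0 !disjoints1 xM.
Qed.

Lemma matching_partner {M x} :
  matching h M -> x \in cover M -> exists y, h x y /\ [set x; y] \in M.
Proof.
case/andP=> /subsetP sM _ /bigcupP[f fM].
have /edgesP[a [b [hab def_f]]] := sM f fM; rewrite def_f in fM *.
rewrite !inE => /orP[] /eqP->; first by exists b.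
by exists a; rewrite h_sym setUC.
Qed.

Lemma matching_coverage {M x y} :
  [set x; y] \in M -> (x \in cover M) * (y \in cover M).
Proof.
by move=> fM; split; apply/bigcupP; exists [set x; y]; rewrite ?inE ?eqxx ?orbT.
Qed.

Lemma card_edge f : f \in edges h -> #|f| = 2.
Proof. by case/edgesP=> x [y [/adjacent_neq xDy ->]]; rewrite cards2 xDy. Qed.

Lemma matching_neq {M x y} : matching h M -> [set x; y] \in M -> x != y.
Proof.
by case/andP=> /subsetP sM _ /sM /card_edge; rewrite cards2; case: eqP.
Qed.

Lemma card_matching M : matching h M -> #|cover M| = #|M|.*2.
Proof.
case/andP=> /subsetP sM /eqP tM; rewrite -tM -muln2 -sum_nat_const.
by apply: eq_bigr => f /sM /card_edge.
Qed.

(** An edge between two missed vertices could be added. Conversely, edges of a larger matching are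
    disjoint, so one outside [M] avoids [cover M] and joins two missed vertices. *)
Lemma maximal_matchingP M :
  reflect (matching h M /\ independent h (~: cover M)) (maximal_matching h M).
Proof.
apply: (iffP maxsetP) => [[mM maxM]|[mM /independentP indM]]; split => //.
  apply/independentP => x y; rewrite !inE => xM yM; apply/negP => hxy.
  have [mM' cM'] := matchingU1 mM hxy xM yM.
  have eM := maxM _ mM' (subsetUr _ _).
  by move: xM; rewrite -eM cM' !inE eqxx.
move=> N mN sMN; apply/eqP; rewrite eqEsubset sMN andbT.
apply/subsetP => f fN; apply: contraT => fM.
have [/subsetP sN tN] := andP mN.
have /edgesP[x [y [hxy def_f]]] := sN f fN.
have missed t : t \in f -> t \in ~: cover M.
  move=> tf; rewrite inE; apply/bigcupP => -[f' f'M tf'].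
  have f'N := subsetP sMN _ f'M.
  have ff' : f = f' by rewrite -(def_pblock tN fN tf) (def_pblock tN f'N tf').
  by rewrite ff' f'M in fM.
by rewrite indM ?missed ?def_f ?inE ?eqxx ?orbT in hxy.
Qed.

Lemma maximum_matching_cover {M N} :
  equimatchable h -> matching h M -> independent h (~: cover M) ->
  matching h N -> #|cover N| <= #|cover M|.
Proof.
move=> /forallP/(_ M)/implyP eqm mM iM mN.
have /eqm/andP[_ /forallP/(_ N)/implyP/(_ mN)] : maximal_matching h M.
  exact/maximal_matchingP.
by rewrite !card_matching // leq_double.
Qed.

(** * Graphs with independence number at most 2 *)

Lemma equimatchable_independence2 :
  (forall A, independent h A -> #|A| <= 2) -> odd #|T| -> equimatchable h.
Proof.
move=> ind2 oddT; apply/forallP => M; apply/implyP => /maximal_matchingP[mM iM].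
rewrite /maximum_matching mM; apply/forallP => N; apply/implyP => mN.
(* The number of vertices missed by [M] is odd and at most 2, hence 1, so no matching covers
   more. *)
have := max_card (mem (cover N)); have := cardsC (cover M).
have := ind2 _ iM; rewrite !card_matching // => *; lia.
Qed.

(** Meant for [G - v], whose connectedness comes from 2-connectivity. Any maximal matching is either
    perfect or can be augmented to cover its two missed vertices. *)
Lemma perfect_matching_independence2 :
  connected h -> (forall A, independent h A -> #|A| <= 2) -> ~~ odd #|T| ->
  exists M, perfect_matching h M.
Proof.
move=> /andP[_ connT] ind2 evenT.
apply/existsP; apply: contraT => /existsPn noperf.
have nocover N : matching h N -> (forall t, t \in cover N) -> False.
  move=> mN cN; have := noperf N; rewrite /perfect_matching mN => /negP; apply.
  by apply/eqP/setP => t; rewrite cN inE.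
have [M /maximal_matchingP[mM iM]] : {M | maximal_matching h M}.
  by apply: ex_maxset; exists set0; exact: matching0.
have /cards2P[u [w [uDw defU]]] : #|~: cover M| == 2.
  have := cardsC (cover M); have := ind2 _ iM; rewrite card_matching //.
  case E: #|~: cover M| => [|[|[|n]]] // _ cardT; last by lia.
  case: (nocover M mM) => t; apply: contraT => tM.
  by move/cards0_eq/setP/(_ t): E; rewrite !inE tM.
have missed t : (t \in cover M) = (t != u) && (t != w).
  by move/setP/(_ t): defU; rewrite !inE -negb_or => <-; rewrite negbK.
have uM : u \notin cover M by rewrite missed eqxx.
have wM : w \notin cover M by rewrite missed eqxx andbF.
have huw : h u w = false by apply/(independentP _ iM); rewrite inE.
(* Otherwise [t], [u] and [w] would be three independent vertices. *)
have dom t : t != u -> t != w -> h t u || h t w.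
  move=> tu tw; apply: contraT; rewrite negb_or => /andP[/negbTE htu /negbTE htw].
  have /ind2 : independent h [set t; u; w].
    apply/independentP => i j; rewrite !inE -!orbA.
    by do 2![case/or3P=> /eqP->]; rewrite ?h_irr // h_sym.
  by rewrite setUC cardsU1 cards2 !inE tu negb_or eq_sym tw eq_sym uDw.
(* Augmentation along the path [u x y w]: the edges [ux] and [yw] replace [xy], and everything is
   covered. *)
have aug x y : [set x; y] \in M -> h x u -> h y w -> False.
  move=> xyM hxu hyw; have [xM yM] := matching_coverage xyM.
  have xDy := matching_neq mM xyM.
  have [m1 c1] := matchingD1 mM xyM.
  move: xM yM; rewrite !missed => /andP[xu xw] /andP[yu yw].
  have [||m2 c2] := matchingU1 m1 hyw;
    rewrite ?c1 ?inE ?eqxx ?orbT ?(negbTE wM) ?andbF //.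
  have [||m3 c3] := matchingU1 m2 hxu; rewrite ?c2 ?c1 ?inE ?eqxx ?(negbTE uM)
    ?(negbTE xDy) ?(negbTE xw) ?(negbTE uDw) ?(eq_sym u) ?(negbTE yu) ?andbF //.
  apply: (nocover _ m3) => t; rewrite c3 c2 c1 !inE missed.
  by do !case: eqP.
have [a [b [hab /orP aA bA]]] :
  exists a b, [/\ h a b, (a == u) || h u a & ~~ ((b == u) || h u b)].
  (* The closed neighbourhood of [u] does not contain [w], so by connectedness some edge leaves
     it. *)
  pose A := [pred t | (t == u) || h u t].
  have /existsP[a /existsP[b /and3P[]]] :
    [exists a, exists b, [&& h a b, A a & ~~ A b]].
    apply: contraT => /existsPn noexit.
    have closedA : closed h A.
      apply: intro_closed => [|x y hxy xA]; first exact: sym_connect_sym.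
      apply: contraT => yA; have /existsPn/(_ y) := noexit x.
      by move: xA; rewrite hxy yA andbT !inE => ->.
    have := closed_connect closedA (forallP (forallP connT u) w).
    by rewrite !inE eqxx eq_sym (negbTE uDw) huw.
  by exists a, b.
move: bA; rewrite negb_or => /andP[bu /negbTE hub].
case: aA => [/eqP au|hua]; first by rewrite au hub in hab.
have au : a != u by rewrite eq_sym adjacent_neq.
have aw : a != w by apply: contraFneq huw => <-.
have aM : a \in cover M by rewrite missed au.
have [a' [haa' aa'M]] := matching_partner mM aM.
have := (matching_coverage aa'M).2; rewrite missed => /andP[a'u a'w].
(* If [a'] were adjacent to [w], then [u a a' w] would be augmenting. The same argument gives
   [b != w] and [h b' w]. *)
have ha'u : h a' u.
  case/orP: (dom a' a'u a'w) => // ha'w.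
  by case: (aug a a' aa'M); rewrite // h_sym.
have bw : b != w.
  by apply: contraTneq hab => ->; apply/negP => haw; apply: (aug a' a);
    rewrite // setUC.
have hbw : h b w by have := dom b bu bw; rewrite h_sym hub.
have bM : b \in cover M by rewrite missed bu.
have [b' [hbb' bb'M]] := matching_partner mM bM.
have := (matching_coverage bb'M).2; rewrite missed => /andP[b'u b'w].
have hb'w : h b' w.
  by case/orP: (dom b' b'u b'w) => // hb'u; case: (aug b' b); rewrite // setUC.
have ba' : b != a' by apply: contraFneq hub => ->; rewrite h_sym.
have ba : b != a by rewrite eq_sym adjacent_neq.
have Dbb' : [set b; b'] != [set a; a'].
  by apply/eqP => /setP/(_ b); rewrite !inE eqxx (negbTE ba) (negbTE ba').
have dis : [disjoint [set b; b'] & [set a; a']].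
  by apply: (trivIsetP (andP mM).2).
have /negbT := disjointFr dis (set22 b b').
rewrite !inE negb_or => /andP[b'a b'a'].
have aDa' := adjacent_neq haa'; have bDb' := adjacent_neq hbb'.
(* Augmentation along [u a' a b b' w]: [aa'] and [bb'] leave, then [ab], [a'u] and [b'w] enter. *)
have [m1 c1] := matchingD1 mM aa'M.
have bb'M1 : [set b; b'] \in M :\ [set a; a'] by rewrite !inE Dbb'.
have [m2 c2] := matchingD1 m1 bb'M1.
have [||m3 c3] := matchingU1 m2 hab; rewrite ?c2 ?c1 ?inE ?eqxx ?orbT ?andbF //.
have [||m4 c4] := matchingU1 m3 ha'u; rewrite ?c3 ?c2 ?c1 ?inE ?missed ?eqxx ?orbT
   ?(eq_sym u) ?(eq_sym a' a) ?(eq_sym a' b) ?negb_or ?aDa' ?ba' ?au ?bu ?andbF //.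
have [||m5 c5] := matchingU1 m4 hb'w; rewrite ?c4 ?c3 ?c2 ?c1 ?inE ?missed ?eqxx ?orbT
   ?(eq_sym w) ?(eq_sym b' b) ?negb_or ?b'a' ?b'u ?b'a ?bDb' ?a'w ?aw ?bw ?uDw ?andbF //.
case: (nocover _ m5) => t; rewrite c5 c4 c3 c2 c1 !inE missed.
by do !case: eqP.
Qed.

End Matchings.

(** * Transfer to supergraphs and from induced subgraphs *)

Lemma independent_sub {T : finType} {g h : rel T} {A : {set T}} :
  subrel g h -> independent h A -> independent g A.
Proof.
move=> sub /independentP indA; apply/independentP => x y xA yA.
by apply: contraFF (indA x y xA yA); apply: sub.
Qed.

Lemma matching_sub {T : finType} {g h : rel T} {M : {set {set T}}} :
  subrel g h -> matching g M -> matching h M.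
Proof.
move=> sub /andP[/subsetP sM tM]; rewrite /matching tM andbT.
apply/subsetP => f /sM /edgesP[x [y [gxy ->]]].
by apply/edgesP; exists x, y; rewrite sub.
Qed.

Lemma add_edge_sym {T : finType} {g : rel T} {f : {set T}} :
  symmetric g -> symmetric (add_edge g f).
Proof. by move=> g_sym x y; rewrite /add_edge /= g_sym eq_sym setUC. Qed.

Lemma add_edge_irr {T : finType} {g : rel T} {f : {set T}} :
  irreflexive g -> irreflexive (add_edge g f).
Proof. by move=> g_irr x; rewrite /add_edge /= g_irr eqxx. Qed.

Lemma independent_induced {T : finType} {g : rel T} {A : {set T}}
    {B : {set {x : T | x \in A}}} :
  independent (induced g A) B -> independent g (val @: B).
Proof.
move=> /independentP indB; apply/independentP.
by move=> _ _ /imsetP[x xB ->] /imsetP[y yB ->]; apply: indB.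
Qed.

(** The edges are carried along [val], whose injectivity keeps them disjoint. *)
Lemma matching_induced {T : finType} {g : rel T} {A : {set T}}
    {M : {set {set {x : T | x \in A}}}} :
  perfect_matching (induced g A) M ->
  exists2 N, matching g N & cover N = A.
Proof.
case/andP=> /andP[/subsetP sM tM] /eqP cM.
exists [set [set val x | x in f : {set _}] | f in M].
  rewrite /matching imset_trivIset ?tM ?andbT; last exact: val_inj.
  apply/subsetP => _ /imsetP[f /sM /edgesP[x [y [gxy ->]]] ->].
  by apply/edgesP; exists (val x), (val y); split; rewrite // imsetU !imset_set1.
rewrite cover_imset -imset_cover cM; apply/setP => x.
apply/imsetP/idP => [[y _ ->]|xA]; first exact: valP.
by exists (Sub x xA).
Qed.

Lemma independence_number_leP {T : finType} {g : rel T} {k} :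
  reflect (forall A : {set T}, independent g A -> #|A| <= k)
          (independence_number g <= k).
Proof. exact: bigmax_leqP. Qed.

(** * The two implications *)

Section SaturatedEquimatchable.
Context {T : finType} {g : rel T}.
Hypotheses (g_sym : symmetric g) (g_irr : irreflexive g).

Lemma factor_critical_independence2 :
  k_connected 2 g -> odd #|T| -> independence_number g <= 2 ->
  factor_critical g.
Proof.
move=> /andP[_ /forallP conn] oddT /independence_number_leP ind2.
apply/forallP => v; apply/existsP; apply: perfect_matching_independence2.
- by move=> x y; apply: g_sym.
- by move=> x; apply: g_irr.
- by have := conn [set v]; rewrite cards1.
- by move=> A /independent_induced/ind2; rewrite card_imset //; apply: val_inj.
- by rewrite card_sig; have := cardC1 v;
    rewrite (eq_card (_ : _ =i [set~ v])) => [|t]; rewrite ?inE // => ->; move: oddT; case: #|T|.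
Qed.

(** This treats uniformly the case where [xy] is already an edge and the case where it must be
    added; the last clause says that nothing else is new. *)
Lemma exists_equimatchable_supergraph {x y} :
  equimatchable g ->
  (forall f : {set T}, f \in edges (complement g) ->
     equimatchable (add_edge g f)) ->
  x != y ->
  exists h : rel T,
    [/\ symmetric h /\ irreflexive h, subrel g h, h x y, equimatchable h &
        forall a b, h a b -> g a b \/ [set x; y] = [set a; b]].
Proof.
move=> eqm sat xDy; case gxy: (g x y).
  by exists g; split=> // a b ->; left.
exists (add_edge g [set x; y]); split.
- by split; [exact: add_edge_sym | exact: add_edge_irr].
- by move=> a b gab; rewrite /add_edge /= gab.
- by rewrite /add_edge /= xDy eqxx orbT.
- by apply: sat; apply/edgesP; exists x, y; rewrite /complement /= xDy gxy.
- by move=> a b /orP[|/andP[_ /eqP]]; [left | right].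
Qed.

Lemma independence2_saturated :
  equimatchable g -> factor_critical g ->
  (forall f : {set T}, f \in edges (complement g) ->
     equimatchable (add_edge g f)) ->
  independence_number g <= 2.
Proof.
move=> eqm /forallP fc sat; apply/independence_number_leP => A /independentP indA.
rewrite leqNgt; apply/negP => /card_gt2P[x [y [z [[xA yA zA] [xDy yDz zDx]]]]].
have /existsP[P /matching_induced[M mM cM]] := fc z.
have xM : x \in cover M by rewrite cM !inE eq_sym.
have yM : y \in cover M by rewrite cM !inE.
have [x' [gxx' xx'M]] := matching_partner g_sym mM xM.
have [y' [gyy' yy'M]] := matching_partner g_sym mM yM.
(* Partners of [x] and [y] lie outside the independent set, so [x], [x'], [y], [y'] turn out to be
   distinct. *)
have x'y : x' != y by apply: contraTneq gxx' => ->; rewrite indA.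
have y'x : y' != x by apply: contraTneq gyy' => ->; rewrite indA.
have Dxy : [set x; x'] != [set y; y'].
  apply/eqP => /setP/(_ y).
  by rewrite !inE eqxx eq_sym (negbTE xDy) eq_sym (negbTE x'y).
have dis : [disjoint [set x; x'] & [set y; y']].
  exact: (trivIsetP (andP mM).2).
have /negbT := disjointFr dis (set22 x x').
rewrite !inE negb_or => /andP[_ x'y'].
have x'z : x' != z by have := (matching_coverage xx'M).2; rewrite cM !inE.
have y'z : y' != z by have := (matching_coverage yy'M).2; rewrite cM !inE.
have x'x : x' != x by rewrite eq_sym (adjacent_neq g_irr gxx').
have y'y : y' != y by rewrite eq_sym (adjacent_neq g_irr gyy').
have [h [[h_sym h_irr] sub_gh hxy eqh h_new]] :=
  exists_equimatchable_supergraph eqm sat x'y'.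
have mhM := matching_sub sub_gh mM.
have [m1 c1] := matchingD1 mhM xx'M.
have yy'M1 : [set y; y'] \in M :\ [set x; x'] by rewrite !inE eq_sym Dxy.
have [m2 c2] := matchingD1 m1 yy'M1.
have [||m3 c3] := matchingU1 m2 hxy;
  rewrite ?c2 ?c1 ?inE ?eqxx ?orbT ?andbF //.
set N := _ |: _ in m3 c3.
have cN t : (t \in ~: cover N) = [|| t == x, t == y | t == z].
  rewrite c3 c2 c1 cM !inE.
  have [->|tx'] := eqVneq t x'.
    by rewrite (negbTE x'x) (negbTE x'y) (negbTE x'z).
  have [->|ty'] := eqVneq t y'.
    by rewrite (negbTE y'x) (negbTE y'y) (negbTE y'z).
  by do !case: eqP.
(* The possible new edge [x'y'] has its ends covered, so it joins no two missed vertices. *)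
have iN : independent h (~: cover N).
  have sNA t : t \in ~: cover N -> t \in A by rewrite cN => /or3P[] /eqP->.
  apply/independentP => a b aN bN; apply/negP => /h_new[|/setP/(_ x')].
    by rewrite indA ?sNA.
  rewrite !inE eqxx /= => /esym/orP[] /eqP E; move: aN bN; rewrite -E !cN;
  by rewrite (negbTE x'x) (negbTE x'y) (negbTE x'z).
(* [M] misses only [z], so it covers strictly more than the maximal matching [N]. *)
have := maximum_matching_cover h_irr eqh m3 iN mhM.
rewrite leqNgt => /negP; apply; apply: proper_card; apply/properP; split.
  apply/subsetP => t; rewrite cM !inE; apply: contraTneq => ->.
  by have := cN z; rewrite !inE eqxx !orbT.
by exists x => //; have := cN x; rewrite !inE eqxx.
Qed.

End SaturatedEquimatchable.

Theorem theorem19 (T : finType) (g : rel T)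
    (g_sym : symmetric g) (g_irr : irreflexive g)
    (g_2conn : k_connected 2 g) (odd_order : odd #|T|) (order_ge4 : 4 <= #|T|) :
  independence_number g <= 2 <->
  [/\ equimatchable g, factor_critical g &
      forall f : {set T}, f \in edges (complement g) ->
        equimatchable (add_edge g f)].
Proof.
split=> [ind2|[eqm fc sat]]; last exact: independence2_saturated.
have /independence_number_leP ind2P := ind2.
split; first exact: equimatchable_independence2.
  exact: factor_critical_independence2.
(* An independent set of [G + e] is independent in [G], so the bound 2 persists. *)
move=> f _; apply: equimatchable_independence2 => //.
- exact: add_edge_irr.
- by move=> A /independent_sub indA; apply/ind2P/indA => x y;
  rewrite /add_edge /= => ->.
Qed.
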